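(* Let $G=(V,E)$ be a $d$-regular undirected graph with $n$ vertices and diameter $k$, where $d\ge2$. If $n=\alpha\cdot\mu_{d,k}$, then $$h_e(G)\ge\frac{\alpha d}{2k}\cdot\left(1-\frac{1}{(d-1)^k}\right)\qquad\text{and}\qquad \phi_V(G)\ge\frac{\alpha}{2(k-1)+\alpha}.$$
   Context: Graphs are finite and simple; the diameter $k\ge1$ is the maximum distance between two vertices. The Moore Bound is $\mu_{d,k}:=1+d\sum_{i=0}^{k-1}(d-1)^i$. The edge expansion is $h_e(G):=\min_{0<|S|\le n/2}\frac{|e(S,S^c)|}{|S|}$, where $S$ ranges over subsets of $V$, $S^c=V\setminus S$, and $e(S,S^c)$ is the set of edges with one endpoint in $S$ and the other in $S^c$. The vertex expansion is $\phi_V(G):=\min_{0<|S|\le n/2}\frac{|N(S)|}{|S|}$, where $N(S):=\{v\in S^c : \exists u\in S \text{ with } (u,v)\in E\}$. *)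

(* Defs.v *)
From mathcomp Require Import all_boot all_order all_algebra.

Set Implicit Arguments.
Unset Strict Implicit.
Unset Printing Implicit Defensive.

Import Order.TTheory GRing.Theory Num.Theory.

(* A finite simple graph on the vertex set T is a symmetric irreflexive
   relation e : rel T. *)
Section Graphs.

Variables (T : finType) (e : rel T).

Definition nbrs (x : T) : {set T} := [set y | e x y].

Definition regular (d : nat) : Prop := forall x, #|nbrs x| = d.

Definition walk_of_length (m : nat) (x y : T) : bool :=
  [exists p : m.-tuple T, path e x p && (last x p == y)].

(* Least length of a walk from x to y.  Connected vertices are joined by a
   path with fewer than #|T| edges, so searching m < #|T| is enough; the value
   is #|T| when x and y lie in different components. *)
Definition dist (x y : T) : nat :=
  find (fun m => walk_of_length m x y) (iota 0 #|T|).

(* None stands for the infinite diameter of a disconnected graph. *)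
Definition diameter : option nat :=
  if [forall x, forall y, connect e x y]
  then Some (\max_(x : T) \max_(y : T) dist x y) else None.

Definition edge_boundary (S : {set T}) : {set {set T}} :=
  [set [set u; v] | u in S, v in ~: S & e u v].

Definition vertex_boundary (S : {set T}) : {set T} :=
  [set v in ~: S | [exists u in S, e u v]].

Definition small (S : {set T}) : bool := (0 < #|S|) && (2 * #|S| <= #|T|).

Lemma dist_walk x y : connect e x y -> walk_of_length (dist x y) x y.
Proof.
case/connectP=> p0 ep0 ->; case/shortenP: ep0 => p ep up _.
have lt_p : size p < #|T|.
  by rewrite -[(size p).+1]/(size (x :: p)) -(card_uniqP up) max_card.
have hasw : has (fun m => walk_of_length m x (last x p)) (iota 0 #|T|).
  apply/hasP; exists (size p); first by rewrite mem_iota.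
  by apply/existsP; exists (in_tuple p); rewrite ep eqxx.
have := nth_find 0 hasw.
by rewrite nth_iota // -[X in _ < X](size_iota 0 #|T|) -has_find.
Qed.

Lemma dist_min m x y : walk_of_length m x y -> dist x y <= m.
Proof.
move=> w; rewrite leqNgt; apply/negP=> lt_m.
have lt_T : m < #|T|.
  by apply: leq_trans lt_m _; rewrite /dist -[X in _ <= X](size_iota 0) find_size.
by have := before_find 0 lt_m; rewrite nth_iota // add0n w.
Qed.

End Graphs.

Local Open Scope ring_scope.

Section Expansion.

Variables (R : realFieldType) (T : finType) (e : rel T).

(* Minimum of f over the sets S with 0 < |S| <= n/2; the value 0 is taken only
   when there is no such S, that is, when T has at most one element. *)
Definition min_small (f : {set T} -> R) : R :=
  if [pick S | small S] is Some S0
  then f [arg min_(S < S0 | small S) f S]%O else 0.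

Definition edge_expansion : R :=
  min_small (fun S => #|edge_boundary e S|%:R / #|S|%:R).

Definition vertex_expansion : R :=
  min_small (fun S => #|vertex_boundary e S|%:R / #|S|%:R).

Lemma min_smallP (f : {set T} -> R) : (1 < #|T|)%N ->
  (exists2 S, small S & min_small f = f S) /\
  (forall S, small S -> min_small f <= f S).
Proof.
move=> T2; rewrite /min_small; case: pickP => [S0 sS0 | no].
  by case: arg_minP => // S sS minS; split=> //; exists S.
have /card_gt0P[x _] : (0 < #|T|)%N by apply: ltnW.
by have := no [set x]; rewrite /small cards1 muln1 T2.
Qed.

End Expansion.

Definition moore_bound (d k : nat) : nat :=
  (1 + d * \sum_(0 <= i < k) (d - 1) ^ i)%N.

(* Main.v *)
Require Import Defs.
From mathcomp Require Import all_boot all_order all_algebra.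
From mathcomp Require Import zify.

(* For x in S and y outside S, a geodesic from x to y leaves S through a
   boundary edge (u, v).  In a d-regular graph fewer than d neighbours of a
   vertex lie farther from a fixed other vertex, so at most (d - 1)^i vertices x
   are at distance i from u and i + 1 from v, and a given boundary edge serves
   at most \sum_(i < k) \sum_(i <= j < k) (d - 1)^j pairs (x, y).  For the
   vertex expansion the same count is made at v, leaving out the pairs in which
   y is itself in N(S), so that v is an interior vertex of the geodesic. *)

Import Order.TTheory GRing.Theory Num.Theory.
Local Open Scope ring_scope.

Section GeodesicCounting.

Local Open Scope nat_scope.
Set Implicit Arguments.
Unset Strict Implicit.

(** Union bound; every upper count of vertices or pairs below is an instance of it. *)
Lemma card_le_sum_cover (U I : finType) (P : pred I) (A : {set U})
    (F : I -> {set U}) (c : I -> nat) :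
  (forall z, z \in A -> exists2 i, P i & z \in F i) ->
  (forall i, P i -> #|F i| <= c i) ->
  #|A| <= \sum_(i | P i) c i.
Proof.
move=> cov leF; apply: leq_trans (leq_sum _ leF).
have /subset_leq_card/leq_trans : A \subset \bigcup_(i | P i) F i.
  by apply/subsetP => z /cov[i Pi zF]; apply/bigcupP; exists i.
apply; elim/big_rec2: _ => [|i m B _ leB]; first by rewrite cards0.
by apply: leq_trans (leq_card_setU _ _) _; rewrite leq_add2l.
Qed.

Lemma mul_sum_const m c : m * c = \sum_(i < m) c.
Proof. by rewrite sum_nat_const card_ord. Qed.

(** * Distances and geodesics *)

Variables (T : finType) (e : rel T).
Hypothesis e_sym : symmetric e.
Hypothesis e_conn : forall x y, connect e x y.

Local Notation dist := (dist e).

Lemma in_nbrs x y : (y \in nbrs e x) = e x y.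
Proof. by rewrite inE. Qed.

Lemma walk_of_lengthP m x y :
  reflect (exists p, [/\ path e x p, last x p = y & size p = m])
          (walk_of_length e m x y).
Proof.
apply: (iffP existsP) => [[p /andP[ep /eqP lp]] | [p [ep lp /eqP sp]]].
  by exists p; rewrite size_tuple.
by exists (Tuple sp); rewrite ep lp eqxx.
Qed.

Lemma distP x y : exists p, [/\ path e x p, last x p = y & size p = dist x y].
Proof. by apply/walk_of_lengthP/dist_walk. Qed.

Lemma dist_le p x : path e x p -> dist x (last x p) <= size p.
Proof. by move=> ep; apply/dist_min/walk_of_lengthP; exists p. Qed.

Lemma distxx x : dist x x = 0.
Proof. by apply/eqP; rewrite -leqn0 (@dist_le [::]). Qed.

Lemma dist_eq0 x y : (dist x y == 0) = (x == y).
Proof.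
apply/eqP/eqP => [d0 | ->]; last exact: distxx.
by have [[|z p] [_ // lp]] := distP x y; rewrite d0.
Qed.

Lemma dist_triangle y x z : dist x z <= dist x y + dist y z.
Proof.
have [p [ep <- <-]] := distP x y; have [q [eq <- <-]] := distP (last x p) z.
by rewrite -last_cat -size_cat dist_le // cat_path ep.
Qed.

Lemma distC x y : dist x y = dist y x.
Proof.
suff le a b : dist a b <= dist b a by apply/eqP; rewrite eqn_leq !le.
have [p [ep <- <-]] := distP b a.
have er : path e (last b p) (rev (belast b p)).
  by rewrite rev_path (eq_path (e' := e)) // => u v; rewrite e_sym.
have := dist_le er; rewrite size_rev size_belast.
by case: p {ep er} => [|c p] //=; rewrite rev_cons last_rcons.
Qed.

Lemma dist_edge x y : e x y -> dist x y <= 1.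
Proof. by move=> exy; apply: (@dist_le [:: y]); rewrite /= exy. Qed.

Lemma dist_edge1 x y : irreflexive e -> e x y -> dist x y = 1.
Proof.
move=> e_irr exy; apply/eqP; rewrite eqn_leq dist_edge //= lt0n dist_eq0.
by apply: contraTneq exy => ->; rewrite e_irr.
Qed.

Lemma dist_next m x y :
  dist x y = m.+1 -> exists2 x', e x x' & dist x' y = m.
Proof.
move=> dxy; have [[|x' p] [ep lp sp]] := distP x y.
  by rewrite dxy in sp.
case/andP: ep => exx' ep; exists x' => //.
have := dist_le ep; move: lp sp => /= -> sp.
have := dist_triangle x' x y; have := dist_edge exx'; lia.
Qed.

(** Induction on the distance moves [x] along a geodesic until the next vertex lies outside [S]. *)
Lemma geodesic_exit (S : {set T}) x y : x \in S -> y \notin S ->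
  exists u v, [/\ u \in S, v \notin S, e u v
                & dist x y = (dist x u + dist v y).+1].
Proof.
move=> xS yS; move dxy: (dist x y) => m.
elim: m x xS dxy => [|m IHm] x xS dxy.
  by move/eqP: dxy yS; rewrite dist_eq0 => /eqP<-; rewrite xS.
have [x' exx' dx'y] := dist_next dxy.
have [x'S|x'S] := boolP (x' \in S); last first.
  by exists x, x'; rewrite distxx dx'y.
have [u [v [uS vS euv def_m]]] := IHm x' x'S dx'y.
exists u, v; split=> //.
(* Going through [x'] gives [dist x u <= (dist x' u).+1]; equality holds because the route through
   [u] and [v] is no shorter than [dist x y]. *)
have := dist_triangle x' x u; have := dist_triangle u x y.
have := dist_triangle v u y.
have := dist_edge exx'; have := dist_edge euv; lia.
Qed.

(* The endpoints y of the geodesics from x that pass through v and continue for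
   l further steps. *)
Definition beyond x v l : {set T} :=
  [set y | (dist v y == l) && (dist x y == dist x v + l)].

(** * Counting vertices by distance in a regular graph *)

Variable d : nat.
Hypothesis e_reg : regular e d.

(** Each vertex of layer [l.+1] is adjacent to some [w] in layer [l]. As [x != v], such a [w]
    differs from [x], so one of its [d] neighbours is nearer to [x] and at most [d - 1] are
    farther. *)
Lemma card_beyond x v l : x != v -> #|beyond x v l| <= (d - 1) ^ l.
Proof.
move=> xv; elim: l => [|l IHl].
  rewrite expn0 -(cards1 v); apply/subset_leq_card/subsetP => y.
  by rewrite !inE dist_eq0 eq_sym => /andP[].
rewrite expnSr; apply: (@leq_trans (\sum_(w in beyond x v l) (d - 1))).
  apply: (card_le_sum_cover
            (F := fun w => [set y in nbrs e w | dist x w < dist x y])).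
    move=> y; rewrite inE => /andP[/eqP dvy /eqP dxy].
    (* [w] is the vertex just before [y] on a geodesic from [v]. *)
    rewrite distC in dvy; have [w eyw dwv] := dist_next dvy.
    rewrite e_sym in eyw; have := dist_edge eyw; rewrite distC in dwv.
    have := dist_triangle v x w; have := dist_triangle w x y => h1 h2 h3.
    by exists w; rewrite !inE ?eyw; lia.
  move=> w; rewrite inE => /andP[_ /eqP dxw].
  have : 0 < dist w x by rewrite distC dxw addn_gt0 lt0n dist_eq0 xv.
  case dwx: (dist w x) => [//|m] _; have [z ewz dzx] := dist_next dwx.
  rewrite -(e_reg w) (cardsD1 z (nbrs e w)) in_nbrs ewz add1n subn1 /=.
  apply/subset_leq_card/subsetP => y; rewrite !inE => /andP[-> lt_xwy].
  rewrite andbT; apply: contraTneq lt_xwy => ->.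
  by rewrite (distC x w) (distC x z) dwx dzx ltnNge leqnSn.
by rewrite sum_nat_const leq_mul2r IHl orbT.
Qed.

Hypothesis e_irr : irreflexive e.

Lemma edge_neq u v : e u v -> u != v.
Proof. by apply: contraTneq => ->; rewrite e_irr. Qed.

(** The first step of a geodesic from [v] to [x] is one of [d] neighbours, and [x] lies [i] steps
    beyond it. *)
Lemma card_sphere v i : #|[set x | dist x v == i.+1]| <= d * (d - 1) ^ i.
Proof.
rewrite -[d in d * _](e_reg v) -sum_nat_const.
apply: (card_le_sum_cover (F := fun w => beyond v w i)) => [x | w].
  rewrite inE distC => /eqP dvx; have [w evw dwx] := dist_next dvx.
  by exists w; rewrite inE ?evw // dwx dvx dist_edge1 ?eqxx // add1n eqxx.
by rewrite inE => /edge_neq; apply: card_beyond.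
Qed.

(** * Counting the pairs separated by [S] through its boundary *)

Variable k : nat.
Hypothesis dist_le_k : forall x y, dist x y <= k.

Local Notation M := (\sum_(j < k) (d - 1) ^ j).

Lemma sum_ord_le (P : pred 'I_k) : \sum_(j < k | P j) (d - 1) ^ j <= M.
Proof. by rewrite [leqRHS](bigID P) leq_addr. Qed.

(** A boundary edge has a single orientation leading out of [S], so ordered pairs count the same
    edges. *)
Lemma card_edge_boundary (S : {set T}) : #|edge_boundary e S| =
  #|[set w : T * T | [&& w.1 \in S, w.2 \notin S & e w.1 w.2]]|.
Proof.
rewrite -(card_in_imset (f := fun w : T * T => [set w.1; w.2])).
  apply: eq_card => E; apply/imset2P/imsetP => [[u v uS] | [[u v]]].
    rewrite !inE => /andP[vS euv] ->.
    by exists (u, v) => //; rewrite inE uS vS.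
  rewrite inE /= => /and3P[uS vS euv] ->.
  by exists u v => //; rewrite !inE vS.
move=> [u v] [u' v'] /[!inE] /= /and3P[uS vS _] /and3P[u'S v'S _] /setP eqE.
have := eqE u; have := eqE v; rewrite !inE !eqxx orbT /=.
have /negPf-> : u != v' by apply: contraNneq v'S => <-.
have /negPf-> : v != u' by apply: contraNneq vS => ->.
by rewrite orbF /= => /esym/eqP-> /esym/eqP->.
Qed.

(** For each of the [k] values of [i], the sum over [i <= j < k] is relaxed to the full sum [M]. *)
Lemma edge_boundary_count (S : {set T}) :
  #|S| * #|~: S| <= #|edge_boundary e S| * (k * M).
Proof.
rewrite card_edge_boundary -cardsX -sum_nat_const.
(* Here [i] is [dist x u] and [j] is [dist x u + dist v y], so the bounds on the two factors
   multiply to [(d - 1) ^ j]. *)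
pose F (w : T * T) (i j : 'I_k) :=
  setX (beyond w.2 w.1 i) (beyond w.1 w.2 (j - i)).
apply: (card_le_sum_cover (F := fun w =>
  \bigcup_(i < k) \bigcup_(j < k | i <= j) F w i j)) => [[x y] | w].
  rewrite !inE /= => /andP[xS yS].
  have [u [v [uS vS euv dxy]]] := geodesic_exit xS yS.
  exists (u, v); first by rewrite inE uS vS.
  have lt_k : dist x u + dist v y < k by rewrite -dxy.
  have lt_ik : dist x u < k := leq_ltn_trans (leq_addr _ _) lt_k.
  apply/bigcupP; exists (Ordinal lt_ik) => //.
  apply/bigcupP; exists (Ordinal lt_k); first exact: leq_addr.
  rewrite !inE /= addKn (distC u x) !eqxx /= (distC v u) (dist_edge1 e_irr euv).
  (* Parts of a geodesic are geodesics: [v] is one step farther than [u] from [x], and [u] one step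
     farther than [v] from [y]. *)
  have := dist_triangle u v x; have := dist_triangle v u y.
  have := dist_triangle v x y; have := dist_triangle u x y.
  by rewrite (distC v u) (dist_edge1 e_irr euv) (distC v x) (distC u x); lia.
rewrite inE => /and3P[_ _ euv]; rewrite [leqRHS]mul_sum_const.
apply: (card_le_sum_cover
         (F := fun i : 'I_k => \bigcup_(j < k | i <= j) F w i j)).
  by move=> z /bigcupP[i _ zi]; exists i.
move=> i _; apply: leq_trans (sum_ord_le (fun j => i <= j)).
apply: (card_le_sum_cover (F := F w i)) => [z /bigcupP[j le_ij zj] | j le_ij].
  by exists j.
rewrite cardsX -{2}(subnKC le_ij) expnD.
by rewrite leq_mul ?card_beyond ?(edge_neq euv) // eq_sym edge_neq.
Qed.

(** Since [y] is not in the boundary, [dist v y] is positive, which leaves [k - 1] values for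
    [dist x u]. The factor [d] comes from the sphere around [v] that contains [x]. *)
Lemma vertex_boundary_count (S : {set T}) :
  #|S| * #|~: S :\: vertex_boundary e S|
    <= #|vertex_boundary e S| * ((k - 1) * (d * M)).
Proof.
rewrite -cardsX -sum_nat_const.
pose F v (i : 'I_(k - 1)) (j : 'I_k) : {set T * T} :=
  [set z | (dist z.1 v == i.+1) && (z.2 \in beyond z.1 v (j - i))].
apply: (card_le_sum_cover (F := fun v =>
  \bigcup_(i < k - 1) \bigcup_(j < k | i <= j) F v i j)) => [[x y] | v _].
  rewrite !inE /= => /and3P[xS yN yS]; rewrite yS /= in yN.
  have [u [v [uS vS euv dxy]]] := geodesic_exit xS yS.
  have vN : v \in vertex_boundary e S.
    by rewrite !inE vS; apply/existsP; exists u; rewrite uS.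
  have vy : 0 < dist v y.
    rewrite lt0n dist_eq0; apply: contraNneq yN => <-.
    by apply/existsP; exists u; rewrite uS.
  exists v => //.
  have dxv : dist x v = (dist x u).+1.
    have := dist_triangle u x v; have := dist_triangle v x y.
    by have := dist_edge euv; lia.
  have lt_k : dist x u + dist v y < k by rewrite -dxy.
  have lt_ik : dist x u < k - 1 by lia.
  apply/bigcupP; exists (Ordinal lt_ik) => //.
  apply/bigcupP; exists (Ordinal lt_k); first exact: leq_addr.
  by rewrite !inE /= addKn dxv dxy addSn !eqxx.
rewrite [leqRHS]mul_sum_const.
apply: (card_le_sum_cover
         (F := fun i : 'I_(k - 1) => \bigcup_(j < k | i <= j) F v i j)).
  by move=> z /bigcupP[i _ zi]; exists i.
move=> i _; apply: leq_trans (leq_mul (leqnn d) (sum_ord_le (fun j => i <= j))).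
rewrite big_distrr /=.
apply: (card_le_sum_cover (F := F v i)) => [z /bigcupP[j le_ij zj] | j le_ij].
  by exists j.
rewrite -(subnKC le_ij) expnD mulnA.
apply: leq_trans (leq_mul (card_sphere v i) (leqnn _)).
rewrite -sum_nat_const.
(* The range of [y] depends on [x], so the pairs are counted fibre by fibre over the sphere around
   [v]. *)
apply: (card_le_sum_cover
         (F := fun x => setX [set x] (beyond x v (j - i)))) => [[x y] | x].
  rewrite inE => /andP[dxv yB]; exists x; first by rewrite inE.
  by rewrite in_setX set11.
rewrite inE => /eqP dxv; rewrite cardsX cards1 mul1n card_beyond //.
by rewrite -dist_eq0 dxv.
Qed.

End GeodesicCounting.

Lemma diameter_connect (T : finType) (e : rel T) k :
  diameter e = Some k -> forall x y, connect e x y.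
Proof.
rewrite /diameter; case: ifP => // /forallP conn _ x y.
exact: (forallP (conn x)).
Qed.

Lemma diameter_dist_le (T : finType) (e : rel T) k :
  diameter e = Some k -> forall x y, (dist e x y <= k)%N.
Proof.
rewrite /diameter; case: ifP => // _ [<-] x y.
apply: leq_trans (leq_bigmax (F := fun x => \max_(y : T) dist e x y)%N x).
exact: (leq_bigmax (F := dist e x)).
Qed.

(** Without vertices the maximum is empty and the diameter is [Some 0]. *)
Lemma diameter_gt0 (T : finType) (e : rel T) k :
  diameter e = Some k -> (0 < k)%N -> (0 < #|T|)%N.
Proof.
rewrite /diameter; case: ifP => // _ [<-]; apply: contraTltn.
by rewrite leqn0 => /eqP/card0_eq T0; rewrite big_pred0.
Qed.

Theorem theorem4p3 (R : realFieldType) (T : finType) (e : rel T)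
    (d k : nat) (alpha : R)
    (e_sym : symmetric e) (e_irr : irreflexive e)
    (d_ge2 : (2 <= d)%N) (k_ge1 : (1 <= k)%N)
    (e_reg : regular e d) (e_diam : diameter e = Some k)
    (n_alpha : #|T|%:R = alpha * (moore_bound d k)%:R) :
  alpha * d%:R / (2 * k%:R) * (1 - 1 / (d%:R - 1) ^+ k)
    <= edge_expansion R e
  /\ alpha / (2 * (k%:R - 1) + alpha) <= vertex_expansion R e.
Proof.
have e_conn := diameter_connect e_diam.
have le_k := diameter_dist_le e_diam.
have T_gt0 := diameter_gt0 e_diam k_ge1.
have /card_gt0P[x0 _] := T_gt0.
(* With two vertices a small set exists, so [min_small] does not take its default value 0. *)
have T_gt1 : (1 < #|T|)%N.
  by apply: leq_trans d_ge2 _; rewrite -(e_reg x0) max_card.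
pose M := (\sum_(j < k) (d - 1) ^ j)%N.
have muE : moore_bound d k = (1 + d * M)%N by rewrite /moore_bound big_mkord.
have M_gt0 : (0 < M)%N.
  by rewrite /M; case: (k) k_ge1 => // k' _; rewrite big_ord_recl.
have mu_gt0 : 0 < (moore_bound d k)%:R :> R by rewrite muE ltr0n.
have alpha_gt0 : 0 < alpha.
  by rewrite -(pmulr_lgt0 _ mu_gt0) -n_alpha ltr0n.
have k_gt0 : 0 < k%:R :> R by rewrite ltr0n.
split.
  rewrite /edge_expansion; have [[S /andP[S_gt0 leS] ->] _] :=
    min_smallP (fun S => #|edge_boundary e S|%:R / #|S|%:R : R) T_gt1.
  have cnt := edge_boundary_count e_sym e_conn e_reg e_irr le_k S.
  have cntR : #|S|%:R * (alpha * d%:R)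
      <= #|edge_boundary e S|%:R * (2 * k%:R) :> R.
    have M_gt0R : 0 < M%:R :> R by rewrite ltr0n.
    (* After scaling by [M], the claim follows from [alpha * d * M <= n] (the Moore bound without
       its leading 1) and [n <= 2 * #|~: S|]. *)
    rewrite -(ler_pM2r M_gt0R).
    apply: (@le_trans _ _ (#|S| * #|T|)%:R).
      rewrite natrM n_alpha muE natrD natrM -!mulrA ler_wpM2l //.
      by rewrite (ler_wpM2l (ltW alpha_gt0)) // lerDr.
    rewrite -!natrM ler_nat -/M in cnt *.
    by have := cardsC S; nia.
  (* The count gives [alpha * d / (2 * k)]; the last factor of the claim is at most 1. *)
  apply: (@le_trans _ _ (alpha * d%:R / (2 * k%:R))).
    apply: ler_piMr; first by rewrite !(divr_ge0, mulr_ge0) // ltW.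
    rewrite lerBlDr lerDl divr_ge0 // exprn_ge0 // subr_ge0 ler1n.
    exact: ltnW.
  rewrite ler_pdivrMr ?mulr_gt0 // mulrAC ler_pdivlMr ?ltr0n //.
  by rewrite mulrC.
rewrite /vertex_expansion; have [[S /andP[S_gt0 leS] ->] _] :=
  min_smallP (fun S => #|vertex_boundary e S|%:R / #|S|%:R : R) T_gt1.
have cnt := vertex_boundary_count e_sym e_conn e_reg e_irr le_k S.
have k1E : k%:R - 1 = (k - 1)%:R :> R by rewrite natrB.
have cntR : alpha * #|S|%:R
    <= #|vertex_boundary e S|%:R * (2 * (k%:R - 1) + alpha).
  (* Scaling by the Moore bound turns [alpha] into [n] and leaves an inequality between naturals. *)
  rewrite -(ler_pM2r mu_gt0) mulrAC -n_alpha -mulrA mulrDl -n_alpha k1E.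
  rewrite -!(natrM, natrD) ler_nat muE.
  have NS : vertex_boundary e S \subset ~: S.
    by apply/subsetP => v; rewrite !inE => /andP[].
  (* The removed term [#|S| * #|vertex_boundary e S|] moves to the right, where [2 * #|S| <= n]
     makes it the summand [alpha] of the denominator. *)
  rewrite -/M cardsD (setIidPr NS) in cnt.
  have := cardsC S; have := subset_leq_card NS; nia.
rewrite ler_pdivrMr; last by rewrite ltr_wpDl // k1E -natrM ler0n.
by rewrite mulrAC ler_pdivlMr ?ltr0n.
Qed.
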